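(* Let $\mathbb{G}$ be a $2$-step Carnot group and let $S\subset\mathbb{G}$ be a $C^k$-smooth hypersurface with $k\ge2$. For $y\in S\setminus C_S$ and $t\in\,]-\epsilon,\epsilon[$ ($\epsilon>0$) put $\Phi(y,t):=\exp_{SR}(y,\mathcal{N}(y))(t)$. Let $y_0\in S\setminus C_S$, let $u=(u_1,\dots,u_{n-1})$ be a system of Riemannian normal coordinates on a neighbourhood of $y_0$ in $S$, and let $\mathcal{V}(y)=\frac{\partial y}{\partial u_1}\wedge\dots\wedge\frac{\partial y}{\partial u_{n-1}}$. Then, at non-characteristic points $y$ of this neighbourhood, $$\big|\det[\mathcal{J}_{(y,0)}\Phi]\big|=|\mathcal{P}_H\mathcal{V}(y)|,$$ where $\mathcal{J}_{(y,0)}\Phi$ is the Jacobian matrix of $\Phi$ at $(y,0)$. Therefore $|\det[\mathcal{J}_{(y,0)}\Phi]|\neq0$ at each non-characteristic point $y\in S\setminus C_S$.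
   Context: A $2$-step Carnot group $\mathbb{G}$ is a connected, simply connected nilpotent Lie group of dimension $n$ whose Lie algebra is stratified: $\mathfrak{g}=H\oplus H_2$, $[H,H]=H_2$, $[H,H_2]=0$; $h=\dim H$. Fix a left-invariant frame $X_1,\dots,X_n$ with $X_1,\dots,X_h$ spanning $H$ and $X_{h+1},\dots,X_n$ spanning $H_2$, and the left-invariant Riemannian metric $\langle\cdot,\cdot\rangle$ making it orthonormal; $\mathcal{P}_H$ is the orthogonal projection onto $H$. $\mathbb{G}$ is identified with $\mathbb{R}^n$ through exponential coordinates of the first kind associated with the basis $X_1(0),\dots,X_n(0)$ of $\mathfrak{g}$. $C_S=\{x\in S: H_x\subset T_xS\}$ is the characteristic set of $S$. With $\nu$ the Riemannian unit normal along $S$, $\mathcal{N}=\nu/|\mathcal{P}_H\nu|$ on $S\setminus C_S$. Structural constants: $C^R_{IJ}:=\langle[X_I,X_J],X_R\rangle$; $C^\alpha=[C^\alpha_{IJ}]_{I,J=1,\dots,n}$. For $x_0\in\mathbb{G}$ and $P_0\in T_{x_0}\mathbb{G}\cong\mathbb{R}^n$ (components in the frame), $\exp_{SR}(x_0,P_0)(t)$ is the curve $x(t)$ where $(x,P)$ solves $\dot x=P_H:=\sum_{i\le h}P_iX_i(x)$, $\dot P=-\big(\sum_{\alpha>h}P_\alpha C^\alpha\big)P_H$, $x(0)=x_0$, $P(0)=P_0$ ($P_H$ identified with $(P_1,\dots,P_h,0,\dots,0)\in\mathbb{R}^n$). The Jacobian matrix of $\Phi$ is computed with respect to the coordinates $(u_1,\dots,u_{n-1},t)$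 on the source and the exponential coordinates on $\mathbb{G}$. The vector $\frac{\partial y}{\partial u_1}\wedge\dots\wedge\frac{\partial y}{\partial u_{n-1}}$ is identified with the vector normal to $S$ (up to sign) determined by $\langle\mathcal{V},Z\rangle=\sigma^n\big(\frac{\partial y}{\partial u_1},\dots,\frac{\partial y}{\partial u_{n-1}},Z\big)$ for all $Z$, where $\sigma^n$ is the Riemannian volume form; thus $\nu=\pm\mathcal{V}/|\mathcal{V}|$. *)

(* Defs.v *)
From HB Require Import structures.
From mathcomp Require Import all_boot all_order all_algebra.
From mathcomp Require Import all_classical all_reals all_analysis.

Set Implicit Arguments.
Unset Strict Implicit.
Unset Printing Implicit Defensive.
Import Order.TTheory GRing.Theory Num.Theory.
Import numFieldNormedType.Exports.
Local Open Scope classical_set_scope.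
Local Open Scope ring_scope.

(** Indices are 0-based: the horizontal directions X_1, ..., X_h are those of
    index i < h, the vertical ones those of index h <= i. Vectors are row
    vectors, and the rows of [jacobian f p] are the partial derivatives of f at
    p (the transpose of the usual Jacobian matrix). *)

Section CarnotGroup.
Context {R : realType} {n : nat}.
Implicit Types (h : nat) (x y z v w : 'rV[R]_n).

Definition ebasis (i : 'I_n) : 'rV[R]_n := delta_mx 0 i.

Definition layer1 h : set 'rV[R]_n :=
  [set v | forall i : 'I_n, (h <= i)%N -> v 0 i = 0].
Definition layer2 h : set 'rV[R]_n :=
  [set v | forall i : 'I_n, (i < h)%N -> v 0 i = 0].

(** The stratified Lie algebra g = H (+) H_2, in coordinates with respect to the
    basis X_1(0), ..., X_n(0). As the bracket is bilinear, the finite sums of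
    brackets in [br_gen] form the linear span [H, H]. *)
Record two_step_carnot h := TwoStepCarnot {
  br :> 'rV[R]_n -> 'rV[R]_n -> 'rV[R]_n ;
  br_linear : forall x, linear (br x) ;
  br_anti : forall x y, br x y = - br y x ;
  br_jacobi : forall x y z, br x (br y z) + br y (br z x) + br z (br x y) = 0 ;
  br_gen : layer2 h =
    [set z | exists2 s : seq ('rV[R]_n * 'rV[R]_n),
       forall p, p \in s -> layer1 h p.1 /\ layer1 h p.2 &
       z = \sum_(p <- s) br p.1 p.2] ;
  br_center : forall x z, layer1 h x -> layer2 h z -> br x z = 0 ;
  br_step : (h < n)%N }.

Section Group.
Context {h : nat} (G : two_step_carnot h).

(** Baker-Campbell-Hausdorff formula, which stops at the first bracket in step
    2: the group law in exponential coordinates of the first kind. *)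
Definition mulG x y : 'rV[R]_n := x + y + 2^-1 *: G x y.

(** The left-invariant field equal to the i-th basis vector at 0. *)
Definition lfield (i : 'I_n) x : 'rV[R]_n :=
  derive1 (fun s : R => mulG x (s *: ebasis i)) 0.

Definition lframe x : 'M[R]_n := \matrix_(i < n) lfield i x.

(** Components in the frame of a tangent vector v at x:
    v = \sum_i fcomp x v 0 i *: lfield i x. *)
Definition fcomp x v : 'rV[R]_n := v *m invmx (lframe x).

Definition riem_inner x v w : R := \sum_(i < n) fcomp x v 0 i * fcomp x w 0 i.
Definition riem_norm x v : R := Num.sqrt (riem_inner x v v).

Definition horizontal x : set 'rV[R]_n :=
  [set v | exists c : 'I_n -> R, v = \sum_(i < n | (i < h)%N) c i *: lfield i x].

Definition projH x v : 'rV[R]_n :=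
  \sum_(i < n | (i < h)%N) fcomp x v 0 i *: lfield i x.

(** The Riemannian volume form, evaluated on the rows of E. *)
Definition riem_vol x (E : 'M[R]_n) : R := \det (E *m invmx (lframe x)).

(** The matrix C^a, with entries C^a_{IJ} = <[X_I, X_J], X_a>. *)
Definition Cmat (a : 'I_n) : 'M[R]_n :=
  \matrix_(I, J) (G (ebasis I) (ebasis J)) 0 a.

Definition hpart (P : 'rV[R]_n) : 'rV[R]_n :=
  \row_(i < n) (if (i < h)%N then P 0 i else 0).

Definition sr_extremal (x0 P0 : 'rV[R]_n) (x P : R -> 'rV[R]_n) : Prop :=
  [/\ forall t : R, is_derive t 1 x
        (\sum_(i < n | (i < h)%N) P t 0 i *: lfield i (x t)),
      forall t : R, is_derive t 1 P
        (- ((\sum_(a < n | (h <= a)%N) P t 0 a *: Cmat a)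
             *m (hpart (P t))^T)^T),
      x 0 = x0 & P 0 = P0].

(** The solution of this initial value problem exists on all of R and is
    unique. *)
Definition exp_SR (x0 P0 : 'rV[R]_n) : R -> 'rV[R]_n :=
  get [set x | exists P, sr_extremal x0 P0 x P].

End Group.
End CarnotGroup.

Section Smooth.
Context {R : realType} {V W : normedModType R}.

Fixpoint Ck_on (k : nat) (U : set V) (f : V -> W) : Prop :=
  if k is k'.+1 then
    (forall x, U x -> differentiable f x) /\
    (forall v, Ck_on k' U (fun x => 'D_v f x))
  else forall x, U x -> {for x, continuous f}.

End Smooth.

Section Christoffel.
Context {R : realType} {m : nat} (g : 'rV[R]_m -> 'M[R]_m).

Definition christoffel (v : 'rV[R]_m) (a b c : 'I_m) : R :=
  2^-1 * \sum_(d < m) invmx (g v) c d *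
    ('D_(ebasis a) (fun w => g w b d : R^o) v
     + 'D_(ebasis b) (fun w => g w a d : R^o) v
     - 'D_(ebasis d) (fun w => g w a b : R^o) v).

End Christoffel.

Section Hypersurface.
Context {R : realType} {m h : nat} (G : @two_step_carnot R (m + 1) h).
Implicit Types (S : set 'rV[R]_(m + 1)) (U : set 'rV[R]_m).

(** Embedded hypersurface: locally a regular level set. *)
Definition hypersurface (k : nat) S : Prop :=
  forall x, S x -> exists (W : set 'rV[R]_(m + 1)) (F : 'rV[R]_(m + 1) -> R^o),
    [/\ open W, W x, Ck_on k W F,
        forall y, W y -> exists v, 'D_v F y != 0 &
        S `&` W = [set y | F y = 0] `&` W].

Definition tangent S x : set 'rV[R]_(m + 1) :=
  [set v | exists g : R -> 'rV[R]_(m + 1),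
     [/\ g 0 = x, \forall t \near (0 : R), S (g t) & is_derive (0 : R) 1 g v]].

Definition char_set S : set 'rV[R]_(m + 1) :=
  [set x | S x /\ horizontal G x `<=` tangent S x].

Definition unit_normal S (nu : 'rV[R]_(m + 1) -> 'rV[R]_(m + 1)) : Prop :=
  {within S, continuous nu} /\
  (forall y, S y -> riem_inner G y (nu y) (nu y) = 1 /\
                    forall v, tangent S y v -> riem_inner G y (nu y) v = 0).

Definition Nfield (nu : 'rV[R]_(m + 1) -> 'rV[R]_(m + 1)) y : 'rV[R]_(m + 1) :=
  (riem_norm G y (projH G y (nu y)))^-1 *: nu y.

(** phi is the inverse of a coordinate chart of class C^k of S. The last clause
    says that phi is a homeomorphism onto a relatively open subset of S. *)
Definition local_param (k : nat) S U (phi : 'rV[R]_m -> 'rV[R]_(m + 1)) : Prop :=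
  [/\ open U, Ck_on k U phi,
      forall u, U u -> row_free (jacobian phi u),
      forall u v, U u -> U v -> phi u = phi v -> u = v &
      forall V, open V -> V `<=` U ->
        exists2 W, open W & phi @` V = S `&` W].

(** First fundamental form, i.e. the metric induced on S, in the chart psi. *)
Definition gram (psi : 'rV[R]_m -> 'rV[R]_(m + 1)) v : 'M[R]_m :=
  \matrix_(a, b) riem_inner G (psi v) (row a (jacobian psi v))
                                 (row b (jacobian psi v)).

(** gam is a geodesic of S for the induced metric on the open set J of
    parameters: the geodesic equation holds in charts of class C^k. *)
Definition geodesic (k : nat) S (J : set R) (gam : R -> 'rV[R]_(m + 1)) : Prop :=
  forall t, J t ->
    exists (V : set 'rV[R]_m) (psi : 'rV[R]_m -> 'rV[R]_(m + 1))
           (c : R -> 'rV[R]_m),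
      local_param k S V psi /\
      \forall s \near t,
        [/\ V (c s), gam s = psi (c s), derivable c s 1,
            derivable (derive1 c) s 1 &
            forall d : 'I_m,
              derive1 (derive1 c) s 0 d
              + \sum_(a < m) \sum_(b < m) christoffel (gram psi) (c s) a b d
                  * derive1 c s 0 a * derive1 c s 0 b = 0].

(** Riemannian normal coordinates of S centred at y0, given by the inverse chart
    phi: radial lines are geodesics and the coordinate vectors are orthonormal
    at y0. The exponential map of a C^k hypersurface is in general less than
    C^k, so only the C^1 regularity needed for coordinates is required. *)
Definition normal_coordinates (k : nat) S y0 U
    (phi : 'rV[R]_m -> 'rV[R]_(m + 1)) : Prop :=
  [/\ local_param 1 S U phi,
      U 0 /\ phi 0 = y0,
      forall u (t : R), U u -> 0 <= t <= 1 -> U (t *: u),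
      gram phi 0 = 1%:M &
      forall u, U u ->
        geodesic k S [set t | U (t *: u)] (fun t => phi (t *: u))].

(** The vector E_1 /\ ... /\ E_m at y, for the rows E_a of E; see [wedgeP]. *)
Definition wedge y (E : 'M[R]_(m, m + 1)) : 'rV[R]_(m + 1) :=
  \sum_(i < m + 1) riem_vol G y (col_mx E (lfield G i y)) *: lfield G i y.

End Hypersurface.

Section Facts.
Context {R : realType} {n h : nat} (G : @two_step_carnot R n h).
Implicit Types x y z v w : 'rV[R]_n.

Lemma brD x y z : G x (y + z) = G x y + G x z.
Proof. by have := br_linear G x 1 y z; rewrite !scale1r. Qed.

Lemma br0 x : G x 0 = 0.
Proof. by have := brD x 0 0; rewrite addr0 -{1}[G x 0]addr0 => /addrI. Qed.

Lemma brZ x a y : G x (a *: y) = a *: G x y.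
Proof. by have := br_linear G x a y 0; rewrite br0 !addr0. Qed.

Lemma brDl x y z : G (x + y) z = G x z + G y z.
Proof. by rewrite br_anti brD opprD -!br_anti. Qed.

Lemma br_sum x (I : Type) (s : seq I) (F : I -> 'rV[R]_n) :
  G x (\sum_(i <- s) F i) = \sum_(i <- s) G x (F i).
Proof.
by elim/big_rec2: _ => [|i y1 y2 _ <-]; [exact: br0|exact: brD].
Qed.

Lemma layer_split x : exists y z, [/\ layer1 h y, layer2 h z & x = y + z].
Proof.
exists (\row_i (if (i < h)%N then x 0 i else 0)).
exists (\row_i (if (i < h)%N then 0 else x 0 i)); split.
- by move=> i hi; rewrite mxE ltnNge hi.
- by move=> i hi; rewrite mxE hi.
- by apply/rowP => i; rewrite !mxE; case: ifP; rewrite ?addr0 ?add0r.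
Qed.

Lemma br_layer2r x z : layer2 h z -> G x z = 0.
Proof.
move=> hz; have [y [w [hy hw ->]]] := layer_split x.
rewrite brDl (br_center G hy hz) add0r br_anti.
have [s hs ->] : [set z | exists2 s : seq ('rV[R]_n * 'rV[R]_n),
       forall p, p \in s -> layer1 h p.1 /\ layer1 h p.2 &
       z = \sum_(p <- s) G p.1 p.2] w by rewrite -br_gen.
rewrite br_sum big_seq big1 ?oppr0// => p /hs[p1 p2].
have := br_jacobi G z p.1 p.2.
by rewrite (br_anti G z p.1) !(br_center G _ hz)// oppr0 !br0 !addr0.
Qed.

Lemma br_layer2 x y : layer2 h (G x y).
Proof.
have [x1 [x2 [hx1 hx2 ->]]] := layer_split x.
have [y1 [y2 [hy1 hy2 ->]]] := layer_split y.
rewrite brDl !brD (br_anti G x2 y1) !(br_layer2r _ hy2) (br_layer2r _ hx2) oppr0 !addr0 (br_gen G).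
exists [:: (x1, y1)]; last by rewrite big_seq1.
by move=> p; rewrite inE => /eqP ->.
Qed.

Lemma lfieldE (i : 'I_n) x :
  lfield G i x = ebasis i + 2^-1 *: G x (ebasis i).
Proof.
rewrite /lfield /mulG derive1E.
set w := RHS.
have -> : (fun s : R => x + s *: ebasis i + 2^-1 *: G x (s *: ebasis i)) =
  cst x + (fun s : R => s *: w).
  by apply/funext => s; rewrite fctE brZ /w !scalerDr !scalerA [2^-1 * s]mulrC addrA.
have hd : is_derive (0 : R) 1 (fun s : R => s *: w) w.
  have hw : is_diff (0 : R) (fun s : R => s *: w) (fun s : R => s *: w).
    exact: is_diff_scalel.
  split; first exact: diff_derivable.
  by rewrite deriveE// diff_val scale1r.
by rewrite derive_val add0r.
Qed.

Lemma lframe_unit x : lframe G x \in unitmx.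
Proof.
pose B : 'M[R]_n := \matrix_(i < n) (2^-1 *: G x (ebasis i)).
have FE : lframe G x = 1%:M + B.
  by apply/row_matrixP => i; rewrite rowK lfieldE linearD/= row1 rowK.
have BE v : v *m B = 2^-1 *: G x v.
  rewrite mulmx_sum_row {2}[v]row_sum_delta br_sum scaler_sumr.
  by apply: eq_bigr => i _; rewrite rowK brZ !scalerA mulrC.
have BB : B *m B = 0.
  apply/row_matrixP => i; rewrite row_mul BE rowK row0 brZ br_layer2r ?scaler0//.
  exact: br_layer2.
have: lframe G x *m (1%:M - B) = 1%:M.
  by rewrite FE mulmxBr mulmx1 mulmxDl mul1mx BB addr0 addrK.
by move/mulmx1_unit => [].
Qed.

Lemma fcompK x v : \sum_(i < n) fcomp G x v 0 i *: lfield G i x = v.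
Proof.
rewrite -[RHS](mulmxKV (lframe_unit x)) mulmx_sum_row.
by apply: eq_bigr => i _; rewrite rowK.
Qed.

Lemma fcomp_sum x (c : 'I_n -> R) :
  fcomp G x (\sum_(i < n) c i *: lfield G i x) = \row_i c i.
Proof.
rewrite /fcomp -[RHS](mulmxK (lframe_unit x)) (mulmx_sum_row _ (lframe G x)).
by congr (_ *m _); apply: eq_bigr => i _; rewrite rowK mxE.
Qed.

End Facts.

Lemma wedgeP {R : realType} {m h : nat} (G : @two_step_carnot R (m + 1) h)
    (y : 'rV[R]_(m + 1)) (E : 'M[R]_(m, m + 1)) (Z : 'rV[R]_(m + 1)) :
  riem_inner G y (wedge G y E) Z = riem_vol G y (col_mx E Z).
Proof.
pose c j := cofactor (col_mx (E *m invmx (lframe G y)) (0 : 'rV[R]_(m + 1)))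
              (rshift m ord0) j.
have volE v : riem_vol G y (col_mx E v) = \sum_j c j * fcomp G y v 0 j.
  rewrite /riem_vol mul_col_mx (expand_det_row _ (rshift m ord0)).
  apply: eq_bigr => j _; rewrite col_mxEd mulrC; congr (_ * _).
  rewrite /c /cofactor; congr (_ * \det _).
  apply/matrixP => a b; rewrite !mxE.
  case: splitP => // k /= hk; exfalso.
  have := neq_lift (rshift m ord0) a; rewrite -val_eqE/= hk.
  by rewrite [k]ord1 eqxx.
have -> : wedge G y E = \sum_j c j *: lfield G j y.
  apply: eq_bigr => i _; congr (_ *: _); rewrite volE (bigD1 i)//=.
  have -> : fcomp G y (lfield G i y) = ebasis i.
    rewrite /fcomp -[lfield G i y](rowK (fun i => lfield G i y)).
    by rewrite rowE mulmxK// lframe_unit.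
  rewrite !mxE !eqxx mulr1 big1 ?addr0// => j ji.
  by rewrite !mxE (negPf ji) andbF mulr0.
rewrite volE /riem_inner fcomp_sum.
by apply: eq_bigr => i _; rewrite mxE.
Qed.

(* Main.v *)
Require Import Defs.
From HB Require Import structures.
From mathcomp Require Import all_boot all_order all_algebra.
From mathcomp Require Import all_classical all_reals all_analysis.
From mathcomp Require Import ring lra.

(** The extremal equations decouple: the vertical momentum is constant, the
    horizontal one then solves a linear ODE with constant coefficients, and the
    position is obtained by two quadratures; hence extremals exist. As the
    matrices C^a are skew-symmetric, |P|^2 is conserved, which bounds every
    extremal a priori and gives, locally uniformly in (y, P),
      exp_SR(y, P)(t) = y + t P_H + O(t^2).
    So Phi is differentiable at (y, 0) as soon as the normal field is
    continuous, and its Jacobian there has as rows the derivatives of the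
    chart and P_H(N). In the left-invariant frame, of determinant 1, the
    determinant of that matrix is the inner product of V with P_H(N). Finally
    V and nu are collinear, both being normal to S. *)

Set Implicit Arguments.
Unset Strict Implicit.
Unset Printing Implicit Defensive.
Import Order.TTheory GRing.Theory Num.Theory.
Import numFieldNormedType.Exports.
Local Open Scope classical_set_scope.
Local Open Scope ring_scope.

(** * Limits, derivatives and mean value bounds for row vectors, coordinate by coordinate *)

Section RowVectorCalculus.
Context {R : realType} {n : nat}.
Implicit Types (f : R -> 'rV[R]_n) (v w : 'rV[R]_n).

Lemma rV_norm_le v (e : R) : 0 <= e -> (forall i, `|v 0 i| <= e) -> `|v| <= e.
Proof.
move=> e0 ve; rewrite [leLHS]/Num.Def.normr/= mx_normrE.
by apply/bigmax_leP; split=> // -[i j] _ /=; rewrite [i]ord1.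
Qed.

Lemma coord_le_norm v i : `|v 0 i| <= `|v|.
Proof.
rewrite [leRHS]/Num.Def.normr/= mx_normrE.
exact: (le_bigmax _ (fun ij : 'I_1 * 'I_n => `|v ij.1 ij.2|) (0, i)).
Qed.

Lemma cvg_rV (T : Type) (F : set_system T) (FF : Filter F) (g : T -> 'rV[R]_n) v :
  (forall i, g x 0 i @[x --> F] --> v 0 i) -> g x @[x --> F] --> v.
Proof.
move=> gv; apply/cvgrPdist_le => e e0.
have : \forall x \near F, forall i, `|v 0 i - g x 0 i| <= e.
  by apply: filter_forall => i; move/cvgrPdist_le : (gv i); exact.
apply: filterS => x xe; apply: rV_norm_le => [|i]; first exact: ltW.
by rewrite !mxE.
Qed.

Lemma cvg_coord (T : Type) (F : set_system T) (FF : Filter F) (g : T -> 'rV[R]_n) v i :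
  g x @[x --> F] --> v -> g x 0 i @[x --> F] --> v 0 i.
Proof. exact: (continuous_cvg _ (@coord_continuous R 1 n 0 i v)). Qed.

Let diff_quotE f (t : R) i :
  (fun h : R => h^-1 *: (((fun s => f s 0 i) \o shift t) (h *: 1) - f t 0 i)) =
  (fun h => (h^-1 *: ((f \o shift t) (h *: 1) - f t)) 0 i).
Proof. by apply/funext => h; rewrite !mxE. Qed.

Lemma is_derive_rV f (t : R) v :
  (forall i, is_derive t 1 (fun s => f s 0 i) (v 0 i)) -> is_derive t 1 f v.
Proof.
move=> df; suff fv : h^-1 *: ((f \o shift t) (h *: 1) - f t) @[h --> 0^'] --> v.
  by split; [apply/cvg_ex; exists v|exact: cvg_lim].
apply: cvg_rV => i; have [dfi <-] := df i.
by rewrite -diff_quotE; exact: dfi.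
Qed.

Lemma is_derive_coord f (t : R) v i :
  is_derive t 1 f v -> is_derive t 1 (fun s => f s 0 i) (v 0 i).
Proof.
move=> [df dfv].
suff : h^-1 *: (((fun s => f s 0 i) \o shift t) (h *: 1) - f t 0 i) @[h --> 0^']
    --> v 0 i.
  by move=> fv; split; [apply/cvg_ex; exists (v 0 i)|exact: cvg_lim].
have fv : h^-1 *: ((f \o shift t) (h *: 1) - f t) @[h --> 0^'] --> v.
  by rewrite -dfv; exact: df.
rewrite diff_quotE.
exact: cvg_coord fv.
Qed.

Lemma is_derive_scalel (t : R) v : is_derive t 1 (fun s : R => s *: v) v.
Proof.
have dv : is_diff t (fun s : R => s *: v) (fun s : R => s *: v) by exact: is_diff_scalel.
by split; [exact: diff_derivable|rewrite deriveE// diff_val scale1r].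
Qed.

Lemma mvt_le (f df : R -> R) (C t : R) : (forall s, is_derive s (1 : R) f (df s)) ->
  (forall s, `|s| <= `|t| -> `|df s| <= C) -> `|f t - f 0| <= C * `|t|.
Proof.
move=> fdf dfC.
have cf (a b : R) : {within `[a, b], continuous f}.
  apply: continuous_subspaceT => x.
  exact/differentiable_continuous/derivable1_diffP/(@ex_derive _ _ _ _ _ _ _ (fdf x)).
have [t0|/ltW t0] := leP 0 t.
- have [c] := MVT_segment t0 (fun x _ => fdf x) (cf 0 t).
  rewrite in_itv/= => /andP[c0 ct] ->; rewrite subr0 normrM ler_wpM2r//.
  by apply: dfC; rewrite !ger0_norm.
- have [c] := MVT_segment t0 (fun x _ => fdf x) (cf t 0).
  rewrite in_itv/= => /andP[c0 ct]; rewrite distrC => ->.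
  rewrite sub0r normrM normrN ler_wpM2r//.
  by apply: dfC; rewrite !ler0_norm// lerN2.
Qed.

(** The norm of row vectors is the maximum norm, so the scalar bound passes to vectors with the same
    constant. *)
Lemma mvt_rV_le f (df : R -> 'rV[R]_n) (C t : R) :
  (forall s, is_derive s (1 : R) f (df s)) ->
  (forall s, `|s| <= `|t| -> `|df s| <= C) -> `|f t - f 0| <= C * `|t|.
Proof.
move=> fdf dfC; have C0 : 0 <= C by apply: le_trans (dfC t (lexx _)).
apply: rV_norm_le => [|i]; first exact: mulr_ge0.
rewrite !mxE; apply: (@mvt_le (fun s => f s 0 i) (fun s => df s 0 i)) => s.
  exact: is_derive_coord.
by move=> /dfC; apply: le_trans; exact: coord_le_norm.
Qed.

End RowVectorCalculus.

(** * Linear differential equations with constant coefficients, solved by power series *)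

Section LinearODE.
Context {R : realType} {n : nat} (A : 'M[R]_n).

(** The Taylor coefficients at 0 of coordinate [i] of [v exp(t A)], where [A] acts on row vectors
    from the right. *)
Let coef (v : 'rV[R]_n) (i : 'I_n) (k : nat) : R := iter k (mulmxr A) v 0 i / k`!%:R.

(** The factor produced by termwise differentiation cancels against the factorial. *)
Let coef_diffs v i : pseries_diffs (coef v i) = coef (v *m A) i.
Proof.
apply/funext => k; rewrite /pseries_diffs /coef iterSr factS natrM invfM.
by rewrite mulrCA mulVKf ?pnatr_eq0.
Qed.

Let mulmx_norm (v : 'rV[R]_n) : `|v *m A| <= (\sum_i \sum_j `|A i j|) * `|v|.
Proof.
have S0 : 0 <= \sum_i \sum_j `|A i j|.
  by apply: sumr_ge0 => i _; apply: sumr_ge0.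
apply: rV_norm_le => [|j]; first exact: mulr_ge0.
rewrite mxE mulr_suml (le_trans (ler_norm_sum _ _ _))//; apply: ler_sum => i _.
rewrite normrM mulrC ler_pM ?coord_le_norm// (bigD1 j)//= lerDl.
exact: sumr_ge0.
Qed.

(** Comparison with the exponential series: the [k]-th term is at most [|v| (B |K|)^k / k!]. *)
Let coef_cvg v i K : cvgn (pseries (coef v i) K).
Proof.
apply: normed_cvg; pose B := \sum_i \sum_j `|A i j|.
have B0 : 0 <= B by apply: sumr_ge0 => a _; apply: sumr_ge0.
have itB k : `|iter k (mulmxr A) v| <= B ^+ k * `|v|.
  elim: k => [|k IHk]; first by rewrite expr0 mul1r.
  rewrite iterS exprS -mulrA (le_trans (mulmx_norm _))//.
  exact: ler_wpM2l.
apply: (@series_le_cvg _ _ (fun k => `|v| * exp_coeff (B * `|K|) k)) => k //=.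
- by rewrite mulr_ge0// exp_coeff_ge0// mulr_ge0.
- rewrite /coef /exp_coeff/= exprMn !normrM normfV normr_nat normrX.
  rewrite mulrAC !mulrA ler_wpM2r// ler_wpM2r ?exprn_ge0// mulrC.
  exact: le_trans (coord_le_norm _ _) (itB k).
- rewrite (_ : series _ = (fun N => `|v| * series (exp_coeff (B * `|K|)) N)).
    by apply: is_cvgMr; exact: is_cvg_series_exp_coeff.
  by apply/funext => N; rewrite /series/= mulr_sumr.
Qed.

Let sol v i (t : R) := limn (pseries (coef v i) t).

Let sol_derive v i (t : R) : is_derive t 1 (sol v i) (sol (v *m A) i t).
Proof.
rewrite /sol -coef_diffs; apply: (@pseries_snd_diffs _ _ (`|t| + 1)).
- exact: coef_cvg.
- by rewrite coef_diffs; exact: coef_cvg.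
- by rewrite !coef_diffs; exact: coef_cvg.
- by rewrite [ltRHS]ger0_norm ?ltrDl.
Qed.

(** The factor [A] applied first in the iterated products can as well be applied last, and the
    finite sum over [j] passes to the limit. *)
Let sol_mul v i t : sol (v *m A) i t = \sum_j sol v j t * A j i.
Proof.
apply: cvg_lim => //.
rewrite (_ : pseries _ _ = (fun N => \sum_j (pseries (coef v j) t N * A j i))).
  apply: cvg_big => [|j _]; first exact: add_continuous.
  by apply: cvgMl; exact: coef_cvg.
apply/funext => N; rewrite /pseries/series/=.
under [RHS]eq_bigr do rewrite mulr_suml.
rewrite exchange_big/=; apply: eq_bigr => k _.
rewrite /coef -iterSr iterS/= mxE !mulr_suml; apply: eq_bigr => j _.
by ring.
Qed.

Lemma linear_ode_solution (v : 'rV[R]_n) :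
  exists2 P : R -> 'rV[R]_n, P 0 = v & forall t : R, is_derive t 1 P (P t *m A).
Proof.
exists (fun t => \row_i sol v i t).
  apply/rowP => i; rewrite mxE; apply: cvg_lim => //.
  (* At 0 only the term of index 0 survives, so every partial sum with at least one term equals
     [v 0 i]. *)
  apply/cvg_ballP => e e0; exists 1%N => // -[//|N] _ /=.
  rewrite /pseries/series/= big_nat_recl//= big1 ?addr0; last first.
    by move=> k _; rewrite expr0n mulr0.
  by rewrite /coef/= expr0 mulr1 fact0 divr1; exact: ballxx.
move=> t; apply: is_derive_rV => i; rewrite mxE.
under eq_fun do rewrite mxE.
rewrite (_ : \sum_j _ = sol (v *m A) i t); first exact: sol_derive.
by rewrite sol_mul; apply: eq_bigr => j _; rewrite mxE.
Qed.

End LinearODE.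

(** * Primitives of continuous functions on the whole line *)

Section Primitive.
Context {R : realType}.
Local Notation mu := (@lebesgue_measure R).

(** The fundamental theorem of calculus applies only to the right of the base point of the integral.
    The base point therefore moves with [t], and subtracting the value at 0 makes the result
    independent of it. *)
Lemma continuous_primitive (f : R -> R) : continuous f ->
  exists2 F : R -> R, F 0 = 0 & forall t : R, is_derive t 1 F (f t).
Proof.
move=> cf.
have fint (a b : R) : mu.-integrable `[a, b] (EFin \o f).
  apply: continuous_compact_integrable; first exact: segment_compact.
  exact: continuous_subspaceT.
pose I (a t : R) := (\int[mu]_(x in `[a, t]) f x)%R.
have IB (a b t : R) : a <= b -> b <= t -> I a t - I b t = I a b.
  move=> ab bt; apply/eqP; rewrite subr_eq addrC -subr_eq; apply/eqP.
  rewrite /I (Rintegral_itvB (fint a t)) ?bnd_simp// Rintegral_itv_obnd_cbnd//.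
  by apply: integrableS (fint b t) => //; exact: subset_itv_oc_cc.
pose F (t : R) := I (- (`|t| + 1)) t - I (- (`|t| + 1)) 0.
exists F => [|t]; first by rewrite /F subrr.
(* If [s] is within 1 of [t], then [|s| + 1 <= N]: near [t], all the moving base points can be
   replaced by the fixed one [- N]. *)
pose N := `|t| + 2.
have FN : \forall s \near t, I (- N) s - I (- N) 0 = F s.
  near=> s; rewrite /F; set b := `|s| + 1.
  have bN : - N <= - b.
    have : ball t 1 s by near: s; exact: nbhsx_ballx.
    rewrite -ball_normE/= distrC => ts; rewrite lerN2 /b /N.
    have := ler_normD (s - t) t; rewrite subrK; lra.
  have bs : - b <= s by have := ler_norm (- s); rewrite normrN /b; lra.
  have b0 : - b <= 0 by rewrite oppr_le0 addr_ge0.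
  have := IB _ _ _ bN bs; have := IB _ _ _ bN b0; lra.
apply: near_eq_is_derive FN _.
have Nt : - N < t by have := ler_norm (- t); rewrite normrN /N; lra.
have [] := @continuous_FTC1_closed _ f (- N) t (t + 1) _ (fint _ _) Nt (cf t).
  by rewrite ltrDl.
rewrite derive1E => dI It.
rewrite -[f t]subr0; apply: is_deriveB; first by split.
Unshelve. all: by end_near. Qed.

Lemma continuous_primitive_rV n (f : R -> 'rV[R]_n) : continuous f ->
  exists2 F : R -> 'rV[R]_n, F 0 = 0 & forall t : R, is_derive t 1 F (f t).
Proof.
move=> cf.
have /choice[F HF] i : exists Fi : R -> R,
    Fi 0 = 0 /\ forall t : R, is_derive t 1 Fi (f t 0 i).
  have [|Fi Fi0 dFi] := @continuous_primitive (fun t => f t 0 i); last by exists Fi.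
  by move=> t; exact: cvg_coord (cf t).
exists (fun t => \row_i F i t) => [|t].
  by apply/rowP => i; rewrite !mxE (HF i).1.
apply: is_derive_rV => i; under eq_fun do rewrite mxE.
exact: (HF i).2.
Qed.

End Primitive.

(** * The bracket, the horizontal part and the left-invariant frame in coordinates *)

Section CarnotAlgebra.
Context {R : realType} {n h : nat} (G : @two_step_carnot R n h).
Implicit Types (x y z v w p q : 'rV[R]_n).
Local Notation hpart := (@hpart R n h).

Lemma brZl a x y : G (a *: x) y = a *: G x y.
Proof. by rewrite br_anti brZ (br_anti G x) scalerN. Qed.

Lemma brN x y : G x (- y) = - G x y.
Proof. by rewrite -scaleN1r brZ scaleN1r. Qed.

Lemma brNl x y : G (- x) y = - G x y.
Proof. by rewrite -scaleN1r brZl scaleN1r. Qed.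

Lemma br_suml y (I : Type) (s : seq I) (F : I -> 'rV[R]_n) :
  G (\sum_(i <- s) F i) y = \sum_(i <- s) G (F i) y.
Proof. by rewrite br_anti br_sum -sumrN; apply: eq_bigr => i _; rewrite (br_anti G (F i)). Qed.

Lemma br_self x : G x x = 0.
Proof.
apply/eqP; have /eqP := br_anti G x x; rewrite -addr_eq0 -mulr2n -scaler_nat.
by rewrite scaler_eq0 pnatr_eq0.
Qed.

Lemma br_br x y z : G x (G y z) = 0.
Proof. exact: br_layer2r (br_layer2 G y z). Qed.

Lemma brE x y : G x y =
  \sum_i \sum_j (x 0 i * y 0 j) *: G (ebasis i) (ebasis j).
Proof.
rewrite {1}[x]row_sum_delta br_suml; apply: eq_bigr => i _.
rewrite brZl {1}[y]row_sum_delta br_sum scaler_sumr; apply: eq_bigr => j _.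
by rewrite brZ scalerA.
Qed.

Lemma br_norm : exists2 b : R, 0 <= b & forall x y, `|G x y| <= b * `|x| * `|y|.
Proof.
exists (\sum_i \sum_j `|G (ebasis i) (ebasis j)|).
  by apply: sumr_ge0 => i _; apply: sumr_ge0.
move=> x y; rewrite brE -mulrA mulr_suml (le_trans (ler_norm_sum _ _ _))//.
apply: ler_sum => i _; rewrite mulr_suml (le_trans (ler_norm_sum _ _ _))//.
apply: ler_sum => j _; rewrite normrZ normrM mulrC.
by rewrite ler_wpM2l// ler_pM// coord_le_norm.
Qed.

Lemma cvg_br (T : Type) (F : set_system T) (FF : Filter F) (f g : T -> 'rV[R]_n) x y :
  f t @[t --> F] --> x -> g t @[t --> F] --> y -> G (f t) (g t) @[t --> F] --> G x y.
Proof.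
move=> fx gy; rewrite brE; under eq_fun do rewrite brE.
apply: cvg_big => [|i _]; first exact: add_continuous.
apply: cvg_big => [|j _]; first exact: add_continuous.
by apply: cvgZr_tmp; apply: cvgM; exact: cvg_coord.
Qed.

Lemma hpartE v i : hpart v 0 i = if (i < h)%N then v 0 i else 0.
Proof. by rewrite mxE. Qed.

Lemma hpartD v w : hpart (v + w) = hpart v + hpart w.
Proof. by apply/rowP => i; rewrite !mxE; case: ifP; rewrite ?addr0. Qed.

Lemma hpartZ a v : hpart (a *: v) = a *: hpart v.
Proof. by apply/rowP => i; rewrite !mxE; case: ifP; rewrite ?mulr0. Qed.

Lemma hpartN v : hpart (- v) = - hpart v.
Proof. by apply/rowP => i; rewrite !mxE; case: ifP; rewrite ?oppr0. Qed.

Lemma hpart_norm v : `|hpart v| <= `|v|.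
Proof.
apply: rV_norm_le => // i; rewrite hpartE.
by case: ifP; rewrite ?normr0// coord_le_norm.
Qed.

Lemma cvg_hpart (T : Type) (F : set_system T) (FF : Filter F) (f : T -> 'rV[R]_n) x :
  f t @[t --> F] --> x -> hpart (f t) @[t --> F] --> hpart x.
Proof.
move=> fx; apply: cvg_rV => i; rewrite hpartE; under eq_fun do rewrite hpartE.
case: ifP => _; last exact: cvg_cst.
exact: cvg_coord fx.
Qed.

Lemma layer2_hpart v : layer2 h v -> hpart v = 0.
Proof. by move=> v2; apply/rowP => i; rewrite !mxE; case: ifP => // /v2. Qed.

(** What [hpart] discards lies in the second layer, which is central. *)
Lemma br_hpartr x y : G x (hpart y) = G x y.
Proof.
rewrite -{2}[y](addrNK (hpart y)) brD [X in _ = X + _]br_layer2r ?add0r// => i ih.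
by rewrite !mxE ih subrr.
Qed.

Lemma br_hpartl x y : G (hpart x) y = G x y.
Proof. by rewrite br_anti br_hpartr (br_anti G x). Qed.

Lemma lfield_sum x v : \sum_i v 0 i *: lfield G i x = v + 2^-1 *: G x v.
Proof.
rewrite [X in _ = X + _]row_sum_delta [X in _ = _ + _ *: G x X]row_sum_delta.
rewrite br_sum scaler_sumr -big_split/=.
by apply: eq_bigr => i _; rewrite lfieldE scalerDr brZ !scalerA mulrC.
Qed.

Lemma lfield_hsum x v :
  \sum_(i < n | (i < h)%N) v 0 i *: lfield G i x = hpart v + 2^-1 *: G x v.
Proof.
rewrite -[G x v]br_hpartr -lfield_sum big_mkcond/=; apply: eq_bigr => i _.
by rewrite hpartE; case: ifP; rewrite ?scale0r.
Qed.

(** Passing from components to vectors is [v + 1/2 [x, v]]; as double brackets vanish, changing the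
    sign inverts it. *)
Lemma fcompE x v : fcomp G x v = v - 2^-1 *: G x v.
Proof.
have vE : v = (v - 2^-1 *: G x v) *m lframe G x.
  rewrite mulmx_sum_row; under eq_bigr do rewrite rowK.
  by rewrite lfield_sum brD brN brZ br_br scaler0 subr0 subrK.
by rewrite /fcomp {1}vE mulmxK ?lframe_unit.
Qed.

Lemma fcomp_projH x v : fcomp G x (projH G x v) = hpart (fcomp G x v).
Proof.
rewrite /projH lfield_hsum -[G x _]br_hpartr -lfield_sum fcomp_sum.
by apply/rowP => i; rewrite !mxE.
Qed.

(** The components of [v] differ from [v] by a vertical vector, which neither [hpart] nor the
    bracket with [x] detects. *)
Lemma projHE x v : projH G x v = hpart v + 2^-1 *: G x v.
Proof.
rewrite /projH lfield_hsum fcompE brD brN brZ br_br scaler0 subr0.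
rewrite hpartD hpartN hpartZ [hpart (G x v)]layer2_hpart ?scaler0 ?subr0//.
exact: br_layer2.
Qed.

(* The frame is unitriangular: its off-diagonal entries lie in rows of index < h
   and columns of index >= h. *)
Lemma det_lframe x : \det (lframe G x) = 1.
Proof.
rewrite -det_tr det_trig.
  apply: big1 => i _; rewrite !mxE lfieldE !mxE !eqxx.
  have [ih|ih] := ltnP i h.
    by rewrite (br_layer2 G) ?mulr0 ?addr0.
  rewrite br_layer2r ?mxE ?mulr0 ?addr0// => j jh; rewrite mxE eqxx/=.
  by case: eqP => // ji; move: ih; rewrite -ji leqNgt jh.
apply/is_trig_mxP => i j ij; rewrite !mxE lfieldE !mxE eqxx/=.
rewrite (_ : (i == j) = false) ?add0r; last first.
  by apply/negbTE; rewrite neq_ltn ij.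
have [jh|jh] := ltnP j h.
  by rewrite (br_layer2 G) ?mulr0// (ltn_trans ij).
rewrite br_layer2r ?mxE ?mulr0// => k kh; rewrite mxE eqxx/=.
by case: eqP => // kj; move: jh; rewrite -kj leqNgt kh.
Qed.

End CarnotAlgebra.

(** * Sub-Riemannian extremals: existence, and expansion near time 0 *)

Section Extremals.
Context {R : realType} {n h : nat} (G : @two_step_carnot R n h).
Implicit Types p q : 'rV[R]_n.
Local Notation hpart := (@hpart R n h).

(** Up to sign, the coadjoint action of [q] on the covector [p]: coordinate [i] is the pairing of
    [p] with the bracket of the [i]-th basis vector and [q]. *)
Definition coad p q : 'rV[R]_n :=
  \row_i \sum_a p 0 a * G (ebasis i) q 0 a.

(** Brackets have no horizontal coordinates, so the sum over vertical [a] extends to all [a]; and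
    [hpart] disappears inside a bracket. *)
Lemma coadE p q :
  ((\sum_(a < n | (h <= a)%N) p 0 a *: Cmat G a) *m (hpart q)^T)^T = coad p q.
Proof.
apply/rowP => i; rewrite !mxE.
under eq_bigr do rewrite summxE mulr_suml.
rewrite exchange_big/= big_mkcond/=; apply: eq_bigr => a _.
case: leqP => [_|ah]; last by rewrite (br_layer2 G) ?mulr0.
rewrite -[G _ q]br_hpartr {2}[hpart q]row_sum_delta br_sum summxE mulr_sumr.
by apply: eq_bigr => j _; rewrite brZ !mxE; ring.
Qed.

(** Vertical basis vectors are central. This is the conservation of the vertical momenta. *)
Lemma coad_vert p q (i : 'I_n) : (h <= i)%N -> coad p q 0 i = 0.
Proof.
move=> hi; rewrite mxE big1// => a _; rewrite br_anti br_layer2r ?oppr0 ?mxE ?mulr0//.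
move=> j jh; rewrite mxE eqxx/=; case: eqP => // ji.
by move: hi; rewrite -ji leqNgt jh.
Qed.

Lemma eq_coad p p' q : (forall i : 'I_n, (h <= i)%N -> p 0 i = p' 0 i) ->
  coad p q = coad p' q.
Proof.
move=> pp'; apply/rowP => i; rewrite !mxE; apply: eq_bigr => a _.
have [ah|/pp' -> //] := ltnP a h.
by rewrite (br_layer2 G) ?mulr0.
Qed.

(** The sum is the pairing of [p] with the bracket of [q] with itself. With [p = q] it yields the
    conservation of the Euclidean norm of the momentum. *)
Lemma coad_self p q : \sum_i q 0 i * coad p q 0 i = 0.
Proof.
have /rowP E := br_self G q.
transitivity (\sum_a p 0 a * G q q 0 a); last first.
  by apply: big1 => a _; rewrite E mxE mulr0.
under eq_bigr do rewrite mxE mulr_sumr.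
rewrite exchange_big/=; apply: eq_bigr => a _.
rewrite {3}[q]row_sum_delta br_suml summxE mulr_sumr.
by apply: eq_bigr => i _; rewrite brZl !mxE; ring.
Qed.

Lemma coad_norm : exists2 c : R, 0 <= c & forall p q, `|coad p q| <= c * `|p| * `|q|.
Proof.
have [b b0 Gb] := br_norm G.
exists (n%:R * b) => [|p q]; first by rewrite mulr_ge0.
apply: rV_norm_le => [|i]; first by rewrite !mulr_ge0.
rewrite mxE (le_trans (ler_norm_sum _ _ _))//.
rewrite -!mulrA mulr_natl -[n in _ *+ n]card_ord -sumr_const; apply: ler_sum => a _.
rewrite normrM mulrCA ler_pM// ?coord_le_norm//.
rewrite (le_trans (coord_le_norm _ _))// (le_trans (Gb _ _))// ler_wpM2r//.
rewrite ler_piMr//; apply: rV_norm_le => // j; rewrite mxE.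
by case: (_ && _); rewrite ?normr1 ?normr0.
Qed.

Lemma sr_extremal_exists x0 P0 : exists x P, sr_extremal G x0 P0 x P.
Proof.
(* The matrix of the momentum equation linearised by freezing the covector at [P0]. *)
pose A : 'M[R]_n := \matrix_(j, i) - coad P0 (ebasis j) 0 i.
have AE q : q *m A = - coad P0 q.
  apply/rowP => i; rewrite !mxE.
  rewrite [X in G _ X]row_sum_delta -sumrN.
  under [RHS]eq_bigr => a _ do rewrite br_sum summxE mulr_sumr -sumrN.
  rewrite exchange_big/=; apply: eq_bigr => j _.
  rewrite !mxE mulrN mulr_sumr -sumrN; apply: eq_bigr => a _.
  by rewrite brZ !mxE; ring.
have [P P_0 dP] := linear_ode_solution A P0.
have PV t (i : 'I_n) : (h <= i)%N -> P t 0 i = P0 0 i.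
  move=> hi; rewrite -P_0.
  apply: (@is_derive_0_is_cst _ (fun t => P t 0 i)) => s.
  by have := is_derive_coord i (dP s); rewrite AE [in X in is_derive _ _ _ X]mxE coad_vert ?oppr0.
have cP : continuous P.
  move=> t; exact/differentiable_continuous/derivable1_diffP/(@ex_derive _ _ _ _ _ _ _ (dP t)).
have [Q Q0 dQ] := @continuous_primitive_rV _ _ (fun t => hpart (P t))
  (fun t => cvg_hpart _ (cP t)).
have cQ : continuous Q.
  move=> t; exact/differentiable_continuous/derivable1_diffP/(@ex_derive _ _ _ _ _ _ _ (dQ t)).
(* The position is sought as [x0 + Q + Z] with [Z] vertical. Then [Z] drops out of the bracket with
   [P], and its own equation is a mere quadrature. *)
have [|Z Z0 dZ] := @continuous_primitive_rV _ _ (fun t => 2^-1 *: G (x0 + Q t) (P t)).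
  move=> t; apply: cvgZl_tmp; apply: cvg_br; last exact: cP.
  by apply: cvgD; [exact: cvg_cst|exact: cQ].
have Z2 t : layer2 h (Z t).
  move=> i ih; transitivity (Z 0 0 i); last by rewrite Z0 mxE.
  apply: (@is_derive_0_is_cst _ (fun t => Z t 0 i)) => s.
  by have := is_derive_coord i (dZ s); rewrite [in X in is_derive _ _ _ X]mxE (br_layer2 G) ?mulr0.
exists (fun t => x0 + Q t + Z t), P; split => [t|t||//]; last first.
- by rewrite Q0 Z0 !addr0.
- by rewrite coadE (eq_coad _ (PV t)) -AE.
have GZ : G (Z t) (P t) = 0 by rewrite br_anti br_layer2r ?oppr0.
rewrite lfield_hsum brDl GZ addr0.
rewrite -[hpart (P t)]add0r; apply: is_deriveD; apply: is_deriveD.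
Qed.

(* [exp_SR] picks some extremal: an estimate for all of them makes the
   uniqueness of extremals unnecessary. *)
Lemma sr_extremal_expansion (r : R) : exists2 C : R, 0 <= C &
  forall x0 P0 x P, sr_extremal G x0 P0 x P -> `|x0| <= r -> `|P0| <= r ->
  forall t, `|x t - x0 - t *: (hpart P0 + 2^-1 *: G x0 P0)| <= C * `|t| * `|t|.
Proof.
have [b b0 Gb] := br_norm G; have [c c0 coadc] := coad_norm.
have [r0|r0] := leP 0 r; last first.
  by exists 0 => // x0 P0 x P _ /(le_trans (normr_ge0 _)); rewrite leNgt r0.
(* [M] will bound [|P|]: the conserved sum of squares is at most [n r^2], and [1 + a] dominates the
   square root of [a]. [c2] will bound the velocity of [P]. *)
pose M : R := 1 + n%:R * r ^+ 2; pose c2 : R := c * M * M.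
have M0 : 0 <= M by rewrite addr_ge0// mulr_ge0// sqr_ge0.
have c20 : 0 <= c2 by rewrite !mulr_ge0.
exists (c2 + 2^-1 * (b * M * M + b * r * c2)).
  by rewrite !(addr_ge0, mulr_ge0)// invr_ge0.
move=> x0 P0 x P [dx dP xE PE] x0r P0r.
have {}dx (s : R) : is_derive s 1 x (hpart (P s) + 2^-1 *: G (x s) (P s)).
  by rewrite -lfield_hsum.
have {}dP (s : R) : is_derive s 1 P (- coad (P s) (P s)) by rewrite -coadE.
have PM (s : R) : `|P s| <= M.
  have E : \sum_i P s 0 i ^+ 2 = \sum_i P0 0 i ^+ 2.
    rewrite -PE.
    apply: (@is_derive_0_is_cst _ (fun s => \sum_i P s 0 i ^+ 2)) => u.
    have dPi i := is_derive_coord i (dP u).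
    have := is_derive_sum (fun i => is_deriveM (dPi i) (dPi i)).
    rewrite (_ : \sum_i _ = (fun s => \sum_i P s 0 i ^+ 2)); last first.
      by apply/funext => v; rewrite fct_sumE.
    move=> /is_derive_eq; apply; transitivity (- 2 * \sum_i P u 0 i * coad (P u) (P u) 0 i).
      rewrite mulr_sumr; apply: eq_bigr => i _.
      by rewrite [(- coad _ _) 0 i]mxE /GRing.scale/=; ring.
    by rewrite coad_self mulr0.
  apply: rV_norm_le => // i.
  have Pi : P s 0 i ^+ 2 <= n%:R * r ^+ 2.
    apply: (@le_trans _ _ (\sum_i P s 0 i ^+ 2)).
      by rewrite (bigD1 i)//= lerDl sumr_ge0// => j _; exact: sqr_ge0.
    rewrite E mulr_natl -[n in _ *+ n]card_ord -sumr_const; apply: ler_sum => j _.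
    by rewrite -real_normK ?num_real// lerXn2r ?nnegrE// (le_trans (coord_le_norm _ _)).
  rewrite -real_normK ?num_real// in Pi.
  rewrite /M; have := normr_ge0 (P s 0 i); nra.
have dPM s : `|P s - P0| <= c2 * `|s|.
  rewrite -PE; apply: mvt_rV_le => // u _.
  rewrite normrN (le_trans (coadc _ _))// /c2 -!mulrA ler_wpM2l//.
  by rewrite ler_pM.
(* Only the horizontal part of [x] enters brackets, and its velocity [hpart (P s)] is bounded
   without any prior bound on [x]. *)
have dxM s : `|hpart (x s) - hpart x0| <= M * `|s|.
  rewrite -xE; apply: (@mvt_rV_le _ _ (fun s => hpart (x s)) (fun s => hpart (P s))) => u; last first.
    by move=> _; rewrite (le_trans (hpart_norm _)).
  apply: is_derive_rV => i; rewrite hpartE; under eq_fun do rewrite hpartE.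
  case: ifP => ih; last exact: is_derive_cst.
  have := is_derive_coord i (dx u).
  rewrite [in X in is_derive _ _ _ X]mxE hpartE ih [X in _ + X]mxE.
  by rewrite (br_layer2 G) ?mulr0 ?addr0.
move=> t; set w := _ + _ *: G x0 P0.
have -> : x t - x0 - t *: w = (x t - t *: w) - (x 0 - 0 *: w).
  by rewrite xE scale0r subr0 addrAC.
apply: (@mvt_rV_le _ _ (fun s => x s - s *: w) (fun s => hpart (P s) + 2^-1 *: G (x s) (P s) - w)) => s.
  by apply: is_deriveB; exact: is_derive_scalel.
move=> st.
(* The velocity error is split into the drifts of [P] and of [hpart x], each at most a constant
   times [|t|]; the mean value bound supplies the second factor [|t|]. *)
have -> : hpart (P s) + 2^-1 *: G (x s) (P s) - w =
   hpart (P s - P0) + 2^-1 *: (G (hpart (x s) - hpart x0) (P s) + G x0 (P s - P0)).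
  rewrite /w hpartD hpartN !brD !brN !brDl !brNl !br_hpartl.
  move: (hpart (P s)) (hpart P0) (G (x s) (P s)) (G x0 (P s)) (G x0 P0) => v1 v2 v3 v4 v5.
  by apply/rowP => i; rewrite !mxE; ring.
have xs : `|hpart (x s) - hpart x0| <= M * `|t|.
  by rewrite (le_trans (dxM s))// ler_wpM2l.
have Ps : `|P s - P0| <= c2 * `|t| by rewrite (le_trans (dPM s))// ler_wpM2l.
rewrite (le_trans (ler_normD _ _))// [leRHS]mulrDl lerD//.
  by rewrite (le_trans (hpart_norm _)).
rewrite normrZ ger0_norm ?invr_ge0// -[leRHS]mulrA ler_wpM2l ?invr_ge0//.
rewrite (le_trans (ler_normD _ _))// mulrDl lerD// (le_trans (Gb _ _))//.
  have -> : b * M * M * `|t| = b * (M * `|t|) * M by ring.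
  by rewrite ler_pM ?mulr_ge0// ler_wpM2l.
have -> : b * r * c2 * `|t| = b * r * (c2 * `|t|) by ring.
by rewrite ler_pM ?mulr_ge0// ler_wpM2l.
Qed.

End Extremals.

(** * Expansion of [exp_SR], and linear algebra of the unit normal at a point *)

Section NormalField.
Context {R : realType} {m h : nat} (G : @two_step_carnot R (m + 1) h).
Implicit Types (y v w : 'rV[R]_(m + 1)).
Local Notation hpart := (@hpart R (m + 1) h).

Lemma exp_SR_expansion (r : R) : exists2 C : R, 0 <= C &
  forall x0 P0, `|x0| <= r -> `|P0| <= r -> forall t,
  `|exp_SR G x0 P0 t - x0 - t *: (hpart P0 + 2^-1 *: G x0 P0)| <= C * `|t| * `|t|.
Proof.
have [C C0 HC] := sr_extremal_expansion G r.
exists C => // x0 P0 x0r P0r t.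
have [P xP] : [set x | exists P, sr_extremal G x0 P0 x P] (exp_SR G x0 P0).
  by apply: getPex; exact: sr_extremal_exists.
exact: HC xP x0r P0r t.
Qed.

Lemma riem_innerE y v w : riem_inner G y v w = (fcomp G y v *m (fcomp G y w)^T) 0 0.
Proof. by rewrite mxE; apply: eq_bigr => i _; rewrite [_^T i 0]mxE. Qed.

Lemma riem_innerZl y a v w : riem_inner G y (a *: v) w = a * riem_inner G y v w.
Proof. by rewrite !riem_innerE /fcomp -!scalemxAl mxE. Qed.

Lemma riem_innerZr y a v w : riem_inner G y v (a *: w) = a * riem_inner G y v w.
Proof. by rewrite !riem_innerE /fcomp -scalemxAl linearZ/= -scalemxAr mxE. Qed.

Lemma riem_innerDr y v w z :
  riem_inner G y v (w + z) = riem_inner G y v w + riem_inner G y v z.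
Proof. by rewrite !riem_innerE /fcomp mulmxDl linearD/= mulmxDr mxE. Qed.

Lemma projHZ y a v : projH G y (a *: v) = a *: projH G y v.
Proof. by rewrite !projHE hpartZ brZ scalerDr !scalerA mulrC. Qed.

Lemma riem_inner_ge0 y v : 0 <= riem_inner G y v v.
Proof. by apply: sumr_ge0 => i _; exact: sqr_ge0. Qed.

Lemma riem_normZ y a v : riem_norm G y (a *: v) = `|a| * riem_norm G y v.
Proof.
by rewrite /riem_norm riem_innerZl riem_innerZr mulrA -expr2 sqrtrM ?sqr_ge0// sqrtr_sqr.
Qed.

Lemma riem_inner_projH y v : riem_inner G y v (projH G y v) =
  riem_inner G y (projH G y v) (projH G y v).
Proof.
rewrite /riem_inner fcomp_projH; apply: eq_bigr => i _.
by rewrite hpartE; case: ifP => //; rewrite !mulr0.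
Qed.

Section Normal.
Variables (y nu : 'rV[R]_(m + 1)) (J : 'M[R]_(m, m + 1)).
Hypothesis Jfree : row_free J.
Hypothesis nu1 : riem_inner G y nu nu = 1.
Hypothesis nuJ : forall i, riem_inner G y nu (row i J) = 0.

Lemma normal_mulmx (a : 'rV[R]_m) : riem_inner G y nu (a *m J) = 0.
Proof.
rewrite mulmx_sum_row; elim/big_rec: _ => [|i x _ IH].
  by rewrite -[0 in LHS](scale0r 0) riem_innerZr mul0r.
by rewrite riem_innerDr riem_innerZr nuJ mulr0 add0r.
Qed.

(** In a vanishing combination of the rows, pairing with [nu] kills the coefficient of [nu]; the
    rest vanishes because [J] is row free. *)
Lemma normal_frame_unit : col_mx J nu \in unitmx.
Proof.
rewrite -row_free_unit; apply: inj_row_free => u.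
rewrite -[u]hsubmxK mul_row_col [rsubmx u]mx11_scalar mul_scalar_mx.
set a := lsubmx u; set b := rsubmx u 0 0 => ab0.
have b0 : b = 0.
  have := normal_mulmx 0; rewrite mul0mx -ab0 riem_innerDr normal_mulmx.
  by rewrite riem_innerZr nu1 mulr1 add0r.
move: ab0; rewrite b0 scale0r addr0 => aJ.
have -> : a = 0 by apply: (row_free_inj Jfree); rewrite mul0mx.
by rewrite raddf0 row_mx0.
Qed.

(** The difference [d] of the two sides is orthogonal to [nu] by the choice of the coefficient, and
    to each row of [J] because a volume with two equal rows is zero. These vectors form a basis, so
    [d] vanishes. *)
Lemma wedge_normal : wedge G y J = riem_vol G y (col_mx J nu) *: nu.
Proof.
set l := riem_vol _ _ _; set d := wedge G y J - l *: nu.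
have LU : invmx (lframe G y) \in unitmx by rewrite unitmx_inv lframe_unit.
have dE Z : riem_inner G y d Z = riem_vol G y (col_mx J Z) - l * riem_inner G y nu Z.
  by rewrite -wedgeP -riem_innerZl !riem_innerE /fcomp mulmxBl mulmxBl !mxE.
have TU : col_mx J nu *m invmx (lframe G y) \in unitmx.
  by rewrite unitmx_mul normal_frame_unit.
suff /(canRL (mulKmx TU)) : col_mx J nu *m invmx (lframe G y) *m (fcomp G y d)^T = 0.
  rewrite mulmx0 => /(canRL trmxK); rewrite trmx0 => /(canRL (mulmxK LU)).
  by rewrite mul0mx => /eqP; rewrite subr_eq0 => /eqP.
have inn Z : Z *m invmx (lframe G y) *m (fcomp G y d)^T = (riem_inner G y d Z)%:M.
  rewrite [LHS]mx11_scalar; congr _%:M; rewrite mxE; apply: eq_bigr => i _.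
  by rewrite [_^T i 0]mxE mulrC.
rewrite mul_col_mx mul_col_mx inn dE nu1 mulr1 subrr raddf0.
rewrite (_ : _ *m _ *m _ = 0) ?col_mx0//.
apply/row_matrixP => i; rewrite row0 !row_mul inn dE nuJ mulr0 subr0.
rewrite /riem_vol (@determinant_alternate _ _ _ (lshift 1 i) (rshift m 0)) ?raddf0//.
  by rewrite -val_eqE/= addn0 ltn_eqF.
move=> j; rewrite mul_col_mx col_mxEu col_mxEd.
by rewrite -row_mul !mxE.
Qed.

(** If the horizontal projection of [nu] vanished, every horizontal vector would be orthogonal to
    [nu], hence a combination of the rows of [J], hence tangent: the point would be
    characteristic. *)
Lemma projH_normal_neq0 (S : set 'rV[R]_(m + 1)) :
  (S `\` char_set G S) y -> (forall a, tangent S y (a *m J)) ->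
  riem_norm G y (projH G y nu) != 0.
Proof.
move=> [Sy ychar] JS; apply/eqP => nu0; apply: ychar; split=> // _ [c ->].
have {}nu0 : hpart (fcomp G y nu) = 0.
  have : riem_inner G y (projH G y nu) (projH G y nu) = 0.
    by apply/eqP; rewrite eq_le riem_inner_ge0 andbT -sqrtr_eq0; apply/eqP.
  move=> /psumr_eq0P E; apply/rowP => i; rewrite -fcomp_projH [RHS]mxE.
  by apply/eqP; rewrite -sqrf_eq0 expr2 E// => j _; exact: sqr_ge0.
set w := \sum_(i < _ | _) _.
have wE : fcomp G y w = hpart (\row_i c i).
  rewrite [RHS](_ : _ = \row_i (if (i < h)%N then c i else 0)).
    rewrite -(fcomp_sum G y) /w big_mkcond/=; congr (fcomp G y _).
    by apply: eq_bigr => i _; case: ifP; rewrite ?scale0r.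
  by apply/rowP => i; rewrite !mxE.
have nuw : riem_inner G y nu w = 0.
  rewrite /riem_inner wE big1// => i _; move/rowP/(_ i) : nu0.
  by rewrite !hpartE; case: ifP => _; rewrite ?mulr0// => ->; rewrite [X in X * _]mxE mul0r.
pose u := w *m invmx (col_mx J nu).
have wu : w = lsubmx u *m J + rsubmx u 0 0 *: nu.
  rewrite -mul_scalar_mx -mx11_scalar -mul_row_col hsubmxK.
  by rewrite mulmxKV// normal_frame_unit.
have : rsubmx u 0 0 = 0.
  by move: nuw; rewrite wu riem_innerDr normal_mulmx riem_innerZr nu1 mulr1 add0r.
by rewrite wu => ->; rewrite scale0r addr0; exact: JS.
Qed.

End Normal.
End NormalField.

(** * The Jacobian of a map expanded to first order in its last variable *)

Section JacobianExpansion.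
Context {R : realType}.

Lemma cvg_lsubmx (T : Type) (F : set_system T) (FF : Filter F) n p
    (f : T -> 'rV[R]_(n + p)) (w : 'rV[R]_(n + p)) :
  f t @[t --> F] --> w -> lsubmx (f t) @[t --> F] --> lsubmx w.
Proof.
move=> fw; apply: cvg_rV => i; rewrite mxE; under eq_fun do rewrite mxE.
exact: cvg_coord fw.
Qed.

Lemma cvg_rsubmx (T : Type) (F : set_system T) (FF : Filter F) n p
    (f : T -> 'rV[R]_(n + p)) (w : 'rV[R]_(n + p)) :
  f t @[t --> F] --> w -> rsubmx (f t) @[t --> F] --> rsubmx w.
Proof.
move=> fw; apply: cvg_rV => i; rewrite mxE; under eq_fun do rewrite mxE.
exact: cvg_coord fw.
Qed.

Lemma cvg_mulmxr (T : Type) (F : set_system T) (FF : Filter F) n p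
    (f : T -> 'rV[R]_n) (w : 'rV[R]_n) (A : 'M[R]_(n, p)) :
  f t @[t --> F] --> w -> f t *m A @[t --> F] --> w *m A.
Proof.
move=> fw; apply: cvg_rV => j; rewrite mxE; under eq_fun do rewrite mxE.
apply: cvg_big => [|i _]; first exact: add_continuous.
by apply: cvgMr_tmp; exact: cvg_coord.
Qed.

(* Only the continuity of [g] is required: its variation is multiplied by t. *)
Lemma jacobian_expansion m n (phi g : 'rV[R]_m -> 'rV[R]_n) (F : 'rV[R]_(m + 1) -> 'rV[R]_n)
    (u0 : 'rV[R]_m) (C e : R) : 0 < e -> 0 <= C ->
  differentiable phi u0 -> g u @[u --> u0] --> g u0 ->
  (\forall u \near u0, forall t : R, `|t| < e ->
     `|F (row_mx u t%:M) - phi u - t *: g u| <= C * `|t| * `|t|) ->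
  jacobian F (row_mx u0 0) = col_mx (jacobian phi u0) (g u0).
Proof.
move=> e0 C0 dphi cg HF; set p0 := row_mx u0 0; set A := col_mx _ _.
(* The hypothesis at [t = 0] forces [F] to agree there with [phi]. *)
have Fp0 : F p0 = phi u0.
  have := nbhs_singleton HF => /(_ 0); rewrite normr0 mulr0 scale0r subr0 => /(_ e0).
  by rewrite normr_le0 subr_eq0 raddf0 => /eqP.
suff dF : 'd F p0 = mulmxr A :> ('rV[R]_(m + 1) -> 'rV[R]_n).
  by rewrite /jacobian; apply/matrixP => i j; rewrite mxE dF/= -rowE mxE.
apply: diff_unique; first by move=> v; apply: (@cvg_mulmxr _ (nbhs v) (nbhs_filter v) _ _ id v A); exact: cvg_id.
(* One third each for the remainder of [F] in [t], the variation of [g], and the differentiability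
   of [phi]. *)
apply/eqaddoP => eps eps0; have eps30 : 0 < eps / 3 by rewrite divr_gt0.
have /eqaddoP /(_ _ eps30) phi1 := diff_locally dphi.
have F0 := nbhs_filter (0 : 'rV[R]_(m + 1)).
have id0 : q @[q --> (0 : 'rV[R]_(m + 1))] --> (0 : 'rV[R]_(m + 1)) by exact: cvg_id.
have l0 : lsubmx (0 : 'rV[R]_(m + 1)) = 0 by apply/rowP => i; rewrite !mxE.
have r0 : rsubmx (0 : 'rV[R]_(m + 1)) = 0 by apply/rowP => i; rewrite !mxE.
have lsub0 : lsubmx q @[q --> (0 : 'rV[R]_(m + 1))] --> (0 : 'rV[R]_m).
  by rewrite -[X in _ --> X]l0; exact: cvg_lsubmx.
have rsub0 : `|rsubmx q| @[q --> (0 : 'rV[R]_(m + 1))] --> `|0 : 'rV[R]_1|.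
  by apply: cvg_norm; rewrite -[X in _ --> X]r0; exact: cvg_rsubmx.
have lsubD : lsubmx q + u0 @[q --> (0 : 'rV[R]_(m + 1))] --> u0.
  rewrite -[X in _ --> X]add0r; exact: (cvgD lsub0 (cvg_cst u0)).
have gnear : \forall u \near u0, `|g u0 - g u| <= eps / 3.
  by move/cvgrPdist_le : cg; exact.
have C10 : 0 < C + 1 by rewrite ltr_wpDl.
near=> q.
have HFq : forall t : R, `|t| < e -> `|F (row_mx (lsubmx q + u0) t%:M) -
    phi (lsubmx q + u0) - t *: g (lsubmx q + u0)| <= C * `|t| * `|t|.
  by near: q; exact: (lsubD _ HF).
have te : `|rsubmx q| < e.
  by near: q; apply: cvgr_lt rsub0 _ _; rewrite normr0.
(* This makes [C |t|] at most [eps / 3]; the [+ 1] covers [C = 0]. *)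
have tC : `|rsubmx q| < eps / 3 / (C + 1).
  by near: q; apply: cvgr_lt rsub0 _ _; rewrite normr0 divr_gt0.
have gq : `|g u0 - g (lsubmx q + u0)| <= eps / 3 by near: q; exact: (lsubD _ gnear).
have phiq : `|phi (lsubmx q + u0) - (phi u0 + 'd phi u0 (lsubmx q))| <= eps / 3 * `|lsubmx q|.
  by near: q; exact: (lsub0 _ phi1).
move: HFq te tC gq phiq; set u := lsubmx q; set t := rsubmx q 0 0 => HFq te tC gq phiq.
have tE : `|t| <= `|rsubmx q| by exact: coord_le_norm.
have qE : q + p0 = row_mx (u + u0) t%:M.
  by rewrite -[q in LHS]hsubmxK add_row_mx addr0 [rsubmx q]mx11_scalar.
have uq : `|u| <= `|q| by apply: rV_norm_le => // i; rewrite mxE coord_le_norm.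
have tq : `|t| <= `|q| by rewrite /t mxE coord_le_norm.
have FE : `|F (q + p0) - phi (u + u0) - t *: g (u + u0)| <= eps / 3 * `|q|.
  rewrite qE (le_trans (HFq _ (le_lt_trans tE te)))// ler_pM ?mulr_ge0//.
  rewrite (@le_trans _ _ ((C + 1) * `|t|)) ?ler_wpM2r ?lerDl//.
  by rewrite mulrC -ler_pdivlMr// (le_trans tE) ?ltW.
have gE : `|t *: (g (u + u0) - g u0)| <= eps / 3 * `|q|.
  by rewrite normrZ mulrC ler_pM// distrC.
have phiE : `|phi (u + u0) - phi u0 - u *m jacobian phi u0| <= eps / 3 * `|q|.
  rewrite /jacobian mul_rV_lin1 -addrA -opprD (le_trans phiq)//.
  by rewrite ler_wpM2l// ltW.
rewrite /= !fctE /=.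
have -> : F (q + p0) - (F p0 + q *m A) =
  (F (q + p0) - phi (u + u0) - t *: g (u + u0)) + t *: (g (u + u0) - g u0)
  + (phi (u + u0) - phi u0 - u *m jacobian phi u0).
  rewrite Fp0 -[q in q *m A]hsubmxK mul_row_col [rsubmx q]mx11_scalar mul_scalar_mx.
  rewrite -/u -/t scalerBr.
  move: (F _) (phi _) (phi _) (u *m _) (t *: _) (t *: _) => v1 v2 v3 v4 v5 v6.
  by apply/rowP => i; rewrite !mxE; ring.
rewrite (le_trans (ler_normD _ _))//.
rewrite (_ : eps * _ = (eps / 3 * `|q| + eps / 3 * `|q|) + eps / 3 * `|q|).
  by rewrite lerD// (le_trans (ler_normD _ _))// lerD.
by field.
Unshelve. all: by end_near. Qed.

End JacobianExpansion.

(** * Tangent vectors, non-characteristic points and continuity along a hypersurface *)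

Section Hypersurfaces.
Context {R : realType} {m h : nat} (G : @two_step_carnot R (m + 1) h).

(** The curve [phi (u + s a)] stays in [S] for small [s], as [U] is open. *)
Lemma tangent_param (S : set 'rV[R]_(m + 1)) (U : set 'rV[R]_m)
    (phi : 'rV[R]_m -> 'rV[R]_(m + 1)) u a :
  open U -> U u -> (forall v, U v -> S (phi v)) -> differentiable phi u ->
  tangent S (phi u) (a *m jacobian phi u).
Proof.
move=> oU Uu US dphi; exists (fun s => phi (u + s *: a)); split.
- by rewrite scale0r addr0.
- have su : u + s *: a @[s --> (0 : R)] --> u.
    rewrite -[X in _ --> X]addr0; apply: cvgD; first exact: cvg_cst.
    by rewrite -[X in _ --> X](scale0r a); apply: cvgZr_tmp; exact: cvg_id.
  have nU : nbhs u U by exact: open_nbhs_nbhs.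
  by near=> s; apply: US; near: s; exact: su.
rewrite -(deriveEjacobian _ dphi).
have E : (fun t : R => t^-1 *: (((fun s : R => phi (u + s *: a)) \o shift 0) (t *: 1)
    - phi (u + 0 *: a))) = (fun t : R => t^-1 *: ((phi \o shift u) (t *: a) - phi u)).
  apply/funext => t /=; rewrite scale0r !addr0 [t *: _]mulr1.
  by rewrite [u + _]addrC.
by split; rewrite /derivable /derive E //; exact: diff_derivable.
Unshelve. all: by end_near. Qed.

(** At a characteristic point the horizontal projection of [nu] would be tangent, so its pairing
    with [nu], which is its squared length, would be zero. This criterion makes being
    non-characteristic an open condition. *)
Lemma notin_char_set (S : set 'rV[R]_(m + 1)) nu y : unit_normal G S nu -> S y ->
  riem_norm G y (projH G y (nu y)) != 0 -> (S `\` char_set G S) y.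
Proof.
move=> [_ nuS] Sy nu0; split=> // -[_ HT].
have /HT/(nuS y Sy).2 : horizontal G y (projH G y (nu y)).
  by exists (fun i => fcomp G y (nu y) 0 i).
rewrite riem_inner_projH => E.
by move: nu0; rewrite /riem_norm E sqrtr0 eqxx.
Qed.

Section Continuity.
Variables (T : Type) (F : set_system T) (FF : Filter F).
Variables (x v : T -> 'rV[R]_(m + 1)) (x0 v0 : 'rV[R]_(m + 1)).
Hypotheses (cx : x t @[t --> F] --> x0) (cv : v t @[t --> F] --> v0).

Lemma cvg_fcomp : fcomp G (x t) (v t) @[t --> F] --> fcomp G x0 v0.
Proof.
under eq_fun do rewrite fcompE; rewrite fcompE.
by apply: cvgB => //; apply: cvgZl_tmp; exact: cvg_br.
Qed.

Lemma cvg_projH : projH G (x t) (v t) @[t --> F] --> projH G x0 v0.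
Proof.
under eq_fun do rewrite projHE; rewrite projHE.
by apply: cvgD; [exact: cvg_hpart|apply: cvgZl_tmp; exact: cvg_br].
Qed.

Lemma cvg_riem_norm : riem_norm G (x t) (v t) @[t --> F] --> riem_norm G x0 v0.
Proof.
apply: continuous_cvg; first exact: sqrt_continuous.
apply: cvg_big => [|i _]; first exact: add_continuous.
by apply: cvgM; apply: cvg_coord; exact: cvg_fcomp.
Qed.

End Continuity.

End Hypersurfaces.

Theorem lemma3p2 (R : realType) (m h : nat) (G : @two_step_carnot R (m + 1) h)
    (k : nat) (hk : (2 <= k)%N)
    (S : set 'rV[R]_(m + 1)) (hS : hypersurface k S)
    (nu : 'rV[R]_(m + 1) -> 'rV[R]_(m + 1)) (hnu : unit_normal G S nu)
    (eps : R) (heps : 0 < eps)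
    (Phi : 'rV[R]_(m + 1) -> R -> 'rV[R]_(m + 1))
    (hPhi : forall (y : 'rV[R]_(m + 1)) (t : R),
        (S `\` char_set G S) y -> - eps < t < eps ->
        Phi y t = exp_SR G y (fcomp G y (Nfield G nu y)) t)
    (y0 : 'rV[R]_(m + 1)) (hy0 : (S `\` char_set G S) y0)
    (U : set 'rV[R]_m) (phi : 'rV[R]_m -> 'rV[R]_(m + 1))
    (hphi : normal_coordinates G k S y0 U phi) :
  let Phi_coord := fun p : 'rV[R]_(m + 1) =>
    Phi (phi (lsubmx p)) (rsubmx p 0 0) in
  (forall u : 'rV[R]_m, U u -> (S `\` char_set G S) (phi u) ->
     `|\det (jacobian Phi_coord (row_mx u 0))|
     = riem_norm G (phi u) (projH G (phi u) (wedge G (phi u) (jacobian phi u))))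
  /\
  (forall u : 'rV[R]_m, U u -> (S `\` char_set G S) (phi u) ->
     `|\det (jacobian Phi_coord (row_mx u 0))| != 0).
Proof.
move=> Phi_coord; case: hphi => -[oU [dphi _] Jfree _ opn] _ _ _ _.
have US u : U u -> S (phi u).
  have [W _ UE] := opn U oU (@subset_refl _ U).
  by move=> Uu; have [] : (S `&` W) (phi u) by rewrite -UE; exists u.
(* [c] is the length of the horizontal projection of [nu], [g] the initial velocity of the
   extremals, and [l] the factor of [nu] in the wedge. *)
pose c u := riem_norm G (phi u) (projH G (phi u) (nu (phi u))).
pose g u := projH G (phi u) (Nfield G nu (phi u)).
pose l u := riem_vol G (phi u) (col_mx (jacobian phi u) (nu (phi u))).
have nuJ u : U u -> forall a, riem_inner G (phi u) (nu (phi u)) (a *m jacobian phi u) = 0.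
  move=> Uu a; apply: (hnu.2 _ (US u Uu)).2.
  exact: tangent_param oU Uu US (dphi u Uu).
have nuJrow u (Uu : U u) i : riem_inner G (phi u) (nu (phi u)) (row i (jacobian phi u)) = 0.
  by rewrite rowE nuJ.
have nu1 u (Uu : U u) := (hnu.2 _ (US u Uu)).1.
have c_neq0 u : U u -> (S `\` char_set G S) (phi u) -> c u != 0.
  move=> Uu Su; apply: (projH_normal_neq0 (Jfree u Uu) (nu1 u Uu) (nuJrow u Uu) Su) => a.
  exact: tangent_param oU Uu US (dphi u Uu).
have jacE u : U u -> (S `\` char_set G S) (phi u) ->
    jacobian Phi_coord (row_mx u 0) = col_mx (jacobian phi u) (g u).
  move=> Uu Su; have cu := c_neq0 u Uu Su.
  have Fu := nbhs_filter u.
  have cphi : phi v @[v --> u] --> phi u := differentiable_continuous (dphi u Uu).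
  have nU : \forall v \near u, U v by exact: open_nbhs_nbhs.
  (* [nu] is continuous only within [S], which suffices because [phi] maps [U] into [S]. *)
  have cnu : nu (phi v) @[v --> u] --> nu (phi u).
    move=> V nV; have /subspace_continuousP/(_ _ (US u Uu) V nV) := hnu.1.
    move=> /cphi /= SV; rewrite /nbhs/=; near=> v.
    have : S (phi v) -> V (nu (phi v)) by near: v; exact: SV.
    by apply; apply: US; near: v.
  have cc : c v @[v --> u] --> c u by exact: (cvg_riem_norm Fu cphi (cvg_projH Fu cphi cnu)).
  have cN : Nfield G nu (phi v) @[v --> u] --> Nfield G nu (phi u).
    exact: cvgZ (cvgV cu cc) cnu.
  pose p v := fcomp G (phi v) (Nfield G nu (phi v)).
  have cp : p v @[v --> u] --> p u by exact: (cvg_fcomp Fu cphi cN).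
  (* The margin 1 keeps [phi v] and [p v] in the ball of radius [r] for [v] near [u], so that a
     single constant [C] serves them all. *)
  pose r : R := `|phi u| + `|p u| + 1.
  have [C C0 HC] := exp_SR_expansion G r.
  apply: (jacobian_expansion heps C0 (dphi u Uu)); first exact: (cvg_projH Fu cphi cN).
  near=> v => t te.
  have Uv : U v by near: v.
  (* [Phi] is prescribed at non-characteristic points only; nearby points are such since [c] is
     continuous and nonzero at [u]. *)
  have Sv : (S `\` char_set G S) (phi v).
    apply: (notin_char_set hnu (US v Uv)); rewrite -/(c v).
    by near: v; apply: cvgr_neq0 cc cu.
  rewrite /Phi_coord row_mxKl row_mxKr mxE eqxx mulr1n hPhi//; last by rewrite -ltr_norml.
  have -> : g v = @hpart R (m + 1) h (p v) + 2^-1 *: G (phi v) (p v) by rewrite -lfield_hsum.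
  apply: HC.
    near: v; apply: cvgr_norm_le cphi _ _.
    by rewrite /r -addrA ltrDl ltr_wpDl.
  near: v; apply: cvgr_norm_le cp _ _.
  by rewrite /r addrAC ltrDr ltr_wpDl.
have detE u : U u -> (S `\` char_set G S) (phi u) ->
    \det (jacobian Phi_coord (row_mx u 0)) = l u * c u.
  move=> Uu Su; have cu := c_neq0 u Uu Su.
  (* The frame has determinant 1, so the determinant is a Riemannian volume, that is, the pairing of
     the wedge [l nu] with [g]. As [g] is the projection of [nu] divided by [c], this is
     [l c^2 / c]. *)
  rewrite jacE// -[LHS]mulr1 -[X in _ * X]invr1 -(det_lframe G (phi u)) -det_inv -det_mulmx.
  rewrite -/(riem_vol G (phi u) _) -wedgeP (wedge_normal (Jfree u Uu) (nu1 u Uu) (nuJrow u Uu)).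
  rewrite riem_innerZl /g /Nfield projHZ riem_innerZr riem_inner_projH -/(c u).
  rewrite -[riem_inner _ _ _ _]sqr_sqrtr ?riem_inner_ge0// -/(riem_norm _ _ _) -/(c u).
  by rewrite expr2 mulKf.
have l_neq0 u : U u -> l u != 0.
  move=> Uu; rewrite -unitfE -unitmxE unitmx_mul unitmx_inv lframe_unit andbT.
  exact: normal_frame_unit (Jfree u Uu) (nu1 u Uu) (nuJrow u Uu).
split=> u Uu Su; rewrite detE//; last by rewrite normr_eq0 mulf_neq0 ?l_neq0 ?c_neq0.
(* The projection of the wedge [l nu] has length [|l| c], the absolute value of the determinant. *)
rewrite (wedge_normal (Jfree u Uu) (nu1 u Uu) (nuJrow u Uu)).
by rewrite projHZ riem_normZ normrM [`|c u|]ger0_norm// sqrtr_ge0.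
Unshelve. all: by end_near. Qed.
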